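(* Let $S\in\{L,I\}$ and let $G$ be an S-admissible graph without isolated vertices. Then $\gamma^{\rm STD}(G)\le 2\,\gamma^{\rm S}(G)$.
   Context: Let $G=(V,E)$ be a finite simple graph, $N(v)$ the open and $N[v]=N(v)\cup\{v\}$ the closed neighborhood of $v$. A set $C\subseteq V$ is: a total-dominating set if $N(v)\cap C\neq\emptyset$ for all $v\in V$; a locating set (L-set) if the sets $N(v)\cap C$, $v\in V\setminus C$, are pairwise distinct; a closed-separating set (I-set) if the sets $N[v]\cap C$, $v\in V$, are pairwise distinct. Every graph has an L-set; $G$ is I-admissible if it has an I-set (equivalently, no two adjacent vertices have equal closed neighborhoods). An LTD-code (resp. ITD-code) is a set that is both an L-set (resp. I-set) and a total-dominating set. $\gamma^{\rm S}(G)$ and $\gamma^{\rm STD}(G)$ denote the minimum cardinalities of an S-set and of an STD-code of $G$, respectively. *)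

(* Defs.v *)
From mathcomp Require Import all_boot.

Set Implicit Arguments.
Unset Strict Implicit.
Unset Printing Implicit Defensive.

Section Codes.

Variable T : finType.

(* Minimum cardinality of a set satisfying P; it needs a proof that such a set
   exists, so no default value is involved. *)
Definition min_card (P : pred {set T}) (exP : exists C, P C) : nat :=
  #|[arg min_(C < xchoose exP | P C) #|C|]|.

Lemma min_cardP (P : pred {set T}) (exP : exists C, P C) :
  (exists2 C, P C & #|C| = min_card exP) /\
  (forall C, P C -> min_card exP <= #|C|).
Proof.
rewrite /min_card; case: arg_minnP => [|C PC minC]; first exact: xchooseP.
by split; [exists C | exact: minC].
Qed.

Variable e : rel T.

Definition open_nbhd (v : T) : {set T} := [set u | e v u].

Definition closed_nbhd (v : T) : {set T} := v |: open_nbhd v.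

Definition isolated (v : T) : bool := open_nbhd v == set0.

Definition total_dominating (C : {set T}) : bool :=
  [forall v, open_nbhd v :&: C != set0].

Definition locating (C : {set T}) : bool :=
  dinjectiveb (fun v => open_nbhd v :&: C) (~: C).

Definition closed_separating (C : {set T}) : bool :=
  injectiveb (fun v => closed_nbhd v :&: C).

End Codes.

Variant sep_kind := SepL | SepI.

Definition sep_set (S : sep_kind) (T : finType) (e : rel T) : pred {set T} :=
  match S with
  | SepL => locating e
  | SepI => closed_separating e
  end.

Definition std_code (S : sep_kind) (T : finType) (e : rel T) : pred {set T} :=
  fun C => sep_set S e C && total_dominating e C.

Definition admissible (S : sep_kind) (T : finType) (e : rel T) : Prop :=
  exists C : {set T}, sep_set S e C.

Lemma locatingP (T : finType) (e : rel T) (C : {set T}) :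
  reflect (forall u v, u \notin C -> v \notin C ->
             open_nbhd e u :&: C = open_nbhd e v :&: C -> u = v)
          (locating e C).
Proof.
apply: (iffP (dinjectiveP _ _)) => injC u v.
  by move=> uC vC; apply: injC; rewrite inE.
by rewrite !inE; apply: injC.
Qed.

Lemma closed_separatingP (T : finType) (e : rel T) (C : {set T}) :
  reflect (forall u v,
             closed_nbhd e u :&: C = closed_nbhd e v :&: C -> u = v)
          (closed_separating e C).
Proof. exact: injectiveP. Qed.

Lemma admissibleL (T : finType) (e : rel T) : admissible SepL e.
Proof. by exists [set: T]; apply/locatingP => u v; rewrite inE. Qed.

Lemma std_code_exists (S : sep_kind) (T : finType) (e : rel T) :
  admissible S e -> (forall v, ~~ isolated e v) ->
  exists C : {set T}, std_code S e C.
Proof.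
move=> admS noiso; exists [set: T]; apply/andP; split; last first.
  by apply/forallP => v; rewrite setIT; apply: noiso.
case: S admS => [_ | [C /closed_separatingP sepC]] /=.
  by apply/locatingP => u v; rewrite inE.
apply/closed_separatingP => u v; rewrite !setIT => eq_uv.
by apply: sepC; rewrite eq_uv.
Qed.

Definition gamma_sep (S : sep_kind) (T : finType) (e : rel T)
    (adm : admissible S e) : nat :=
  min_card adm.

Definition gamma_std (S : sep_kind) (T : finType) (e : rel T)
    (adm : admissible S e) (noiso : forall v, ~~ isolated e v) : nat :=
  min_card (std_code_exists adm noiso).

(* Main.v *)
Require Import Defs.
From mathcomp Require Import all_boot.

(** Given a minimum S-set C, add to it one neighbour of each of its vertices.
    This at most doubles C, keeps it an S-set, and totally dominates C and all
    vertices with a neighbour in C.  By separation at most one vertex v outside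
    C has no neighbour in C; any neighbour w of v is then outside C and adjacent
    to some c in C, so choosing w as the neighbour added for c dominates v. *)

Section TotalDomination.

Variables (T : finType) (e : rel T).

Lemma nbhdI_neq0P (C : {set T}) (v : T) :
  reflect (exists2 u, u \in C & e v u) (open_nbhd e v :&: C != set0).
Proof.
apply: (iffP (set0Pn _)) => [[u]|[u uC evu]]; last by exists u; rewrite !inE evu.
by rewrite !inE => /andP[evu uC]; exists u.
Qed.

Lemma neighbor_choice (noiso : forall v, ~~ isolated e v) :
  exists f : T -> T, forall v, e v (f v).
Proof.
have exN v : exists u, e v u.
  by have /set0Pn[u] := noiso v; rewrite inE => evu; exists u.
by exists (fun v => xchoose (exN v)) => v; apply: (xchooseP (exN v)).
Qed.

(** Separation enters only through uniqueness of the undominated vertex outside [C], which lets one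
    argument serve both kinds of code. *)
Lemma total_dominating_extension (C : {set T}) :
  symmetric e -> irreflexive e -> (forall v, ~~ isolated e v) ->
  {in ~: C &, forall u v, open_nbhd e u :&: C = set0 ->
    open_nbhd e v :&: C = set0 -> u = v} ->
  exists D : {set T},
    [/\ C \subset D, total_dominating e D & #|D| <= 2 * #|C|].
Proof.
move=> e_sym e_irr noiso uniqC.
have [f ef] := neighbor_choice noiso.
(* [D] will be [C :|: g @: C]; only vertices outside [C] without a neighbour in [C] constrain the
   choice of [g]. *)
suff [g eg domg] : exists2 g : T -> T, forall c, e c (g c) &
    forall v, v \notin C -> open_nbhd e v :&: C = set0 ->
      exists2 c, c \in C & e v (g c).
  exists (C :|: g @: C); split; first exact: subsetUl.
    apply/forallP => v; apply/nbhdI_neq0P.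
    have [vC | vC] := boolP (v \in C).
      by exists (g v) => //; rewrite inE imset_f ?orbT.
    have [/eqP v0 | /nbhdI_neq0P[u uC evu]] :=
      boolP (open_nbhd e v :&: C == set0).
      have [c cC evc] := domg v vC v0.
      by exists (g c) => //; rewrite inE imset_f ?orbT.
    by exists u => //; rewrite inE uC.
  rewrite mul2n -addnn (leq_trans (leq_card_setU _ _)) //.
  by rewrite leq_add2l leq_imset_card.
have [/existsP[v /andP[vC /eqP v0]] | noV] :=
  boolP [exists v, (v \notin C) && (open_nbhd e v :&: C == set0)]; last first.
  exists f => // v vC v0; case/existsP: noV.
  by exists v; rewrite vC v0 eqxx.
pose w := f v.
have wC : w \notin C.
  by apply/negP => wC; have := in_set0 w; rewrite -v0 !inE ef wC.
(* Otherwise uniqueness forces [v = w], making [e v w] a loop. *)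
have /nbhdI_neq0P[c cC ewc] : open_nbhd e w :&: C != set0.
  apply/eqP => w0; have := ef v.
  by rewrite -/w (uniqC v w) ?inE ?e_irr.
(* Redirecting [f] at [c] alone suffices, since every undominated [u] outside [C] equals [v]. *)
exists (fun x => if x == c then w else f x) => [x | u uC u0].
  by case: eqP => [-> | _]; [rewrite e_sym | apply: ef].
by exists c => //; rewrite eqxx (uniqC u v) ?inE //; apply: ef.
Qed.

Lemma setI_eq_subset (A B C D : {set T}) :
  C \subset D -> A :&: D = B :&: D -> A :&: C = B :&: C.
Proof. by move=> /setIidPr <- eqD; rewrite !setIA eqD. Qed.

(** Equal traces on [D] restrict to equal traces on [C]; for L-sets, vertices outside [D] are also
    outside [C]. *)
Lemma sep_setS (S : sep_kind) (C D : {set T}) :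
  C \subset D -> sep_set S e C -> sep_set S e D.
Proof.
move=> sCD; case: S => /=.
  move/locatingP=> sepC; apply/locatingP => u v uD vD.
  move/(setI_eq_subset _ _ _ _ sCD).
  by apply: sepC; apply: contra (subsetP sCD _) _.
move/closed_separatingP=> sepC; apply/closed_separatingP => u v.
by move/(setI_eq_subset _ _ _ _ sCD); apply: sepC.
Qed.

Lemma closed_nbhdI_notin (C : {set T}) (v : T) :
  v \notin C -> closed_nbhd e v :&: C = open_nbhd e v :&: C.
Proof.
move=> vC; apply/setP => u; rewrite !inE; case: eqP => // ->.
by rewrite (negPf vC) !andbF.
Qed.

(** Both vertices have empty trace on [C]; outside [C], open and closed neighbourhoods leave the
    same trace. *)
Lemma sep_set_undominated_uniq (S : sep_kind) (C : {set T}) :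
  sep_set S e C ->
  {in ~: C &, forall u v, open_nbhd e u :&: C = set0 ->
    open_nbhd e v :&: C = set0 -> u = v}.
Proof.
case: S => /= [/locatingP | /closed_separatingP] sepC u v;
  rewrite !inE => uC vC u0 v0; apply: sepC => //.
  by rewrite u0.
by rewrite !closed_nbhdI_notin // u0.
Qed.

End TotalDomination.

Theorem theorem5 (S : sep_kind) (T : finType) (e : rel T)
    (e_sym : symmetric e) (e_irr : irreflexive e)
    (adm : admissible S e) (noiso : forall v : T, ~~ isolated e v) :
  gamma_std adm noiso <= 2 * gamma_sep adm.
Proof.
have [[C sepC cardC] _] := min_cardP adm.
have [_ min_std] := min_cardP (std_code_exists adm noiso).
have [D [sCD domD cardD]] :=
  total_dominating_extension _ _ _ e_sym e_irr noiso
    (sep_set_undominated_uniq _ _ _ _ sepC).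
rewrite /gamma_sep -cardC; apply: leq_trans cardD; apply: min_std.
by rewrite /std_code (sep_setS _ _ _ _ _ sCD sepC).
Qed.
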